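(* Let $B\in\mathbb{R}^{(n-1)\times n}$ be defined by $Bx=[x_1-x_2,\dots,x_{n-1}-x_n]^T$ for $x\in\mathbb{R}^n$. Let $\Sigma\in\mathbb{R}^{(n-1)\times(n-1)}$ be an $N$-block diagonal matrix $\Sigma=\mathrm{Diag}(\Lambda_1,\dots,\Lambda_N)$, where for $i=1,\dots,N$, $\Lambda_i$ is either the $n_i\times n_i$ zero matrix $\mathbf{O}_{n_i}$ or the $n_i\times n_i$ identity matrix $I_{n_i}$, and any two consecutive blocks cannot be of the same type. Denote $J:=\{j \mid \Lambda_j=I_{n_j},\ j=1,\dots,N\}$. Then $$\Gamma:=I_n-B^T(\Sigma BB^T\Sigma)^\dagger B=\mathrm{Diag}(\Gamma_1,\dots,\Gamma_N),$$ where for $i=1,\dots,N$, $$\Gamma_i=\begin{cases}\frac{1}{n_i+1}\mathbf{E}_{n_i+1}, & \text{if } i\in J,\\ I_{n_i}, & \text{if } i\notin J\text{ and } i=1\text{ or }N,\\ I_{n_i-1}, & \text{otherwise,}\end{cases}$$ with the convention $I_0=\emptyset$. Moreover, $\Gamma=H+UU^T=H+U_JU_J^T$, where $H\in\mathbb{R}^{n\times n}$ is the $N$-block diagonal matrix $H=\mathrm{Diag}(\Upsilon_1,\dots,\Upsilon_N)$ with $$\Upsilon_i=\begin{cases}\mathbf{O}_{n_i+1}, & \text{if } i\in J,\\ I_{n_i}, & \text{if } i\notin J\text{ and } i=1\text{ or }N,\\ I_{n_i-1}, & \text{otherwise,}\end{cases}$$ $U\in\mathbb{R}^{n\times N}$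 has $(k,j)$-th entry $$U_{k,j}=\begin{cases}\frac{1}{\sqrt{n_j+1}}, & \text{if } \sum_{t=1}^{j-1}n_t+1\le k\le\sum_{t=1}^{j}n_t+1\text{ and } j\in J,\\ 0, & \text{otherwise,}\end{cases}$$ and $U_J$ consists of the nonzero columns of $U$, i.e. the columns whose indices are in $J$.
   Context: $\mathbf{E}_k$ is the $k\times k$ matrix of all ones, $\mathbf{O}_k$ the $k\times k$ zero matrix, $I_k$ the $k\times k$ identity matrix ($I_0=\emptyset$ means an empty block), and $^\dagger$ denotes the Moore-Penrose pseudo-inverse. $\mathrm{Diag}(\cdot,\dots,\cdot)$ of matrices denotes the block diagonal matrix with those diagonal blocks.
   Formalization: The case N = 1 with Λ_1 the zero matrix (and an empty block list) is excluded: there Γ = I_n, while the stated formula gives Diag(Γ_1) = I_{n-1}, of the wrong size, so the claim fails. *)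

(* Defs.v *)
From mathcomp Require Import all_boot all_order all_algebra.
Set Implicit Arguments.
Unset Strict Implicit.
Unset Printing Implicit Defensive.
Import Order.TTheory GRing.Theory Num.Theory.
Local Open Scope ring_scope.

(* The four Penrose equations, over an ordered field with trivial
   conjugation. *)
Definition penrose (R : realFieldType) (m n : nat)
    (A : 'M[R]_(m, n)) (X : 'M[R]_(n, m)) : bool :=
  [&& A *m X *m A == A, X *m A *m X == X,
      (A *m X)^T == A *m X & (X *m A)^T == X *m A].

Lemma gram_eq0 (R : realFieldType) (m n : nat) (A : 'M[R]_(m, n)) :
  A *m A^T = 0 -> A = 0.
Proof.
move=> A0; apply/matrixP => i j; rewrite mxE.
have /matrixP/(_ i i) := A0; rewrite !mxE => /eqP.
rewrite psumr_eq0; last by move=> k _; rewrite mxE -expr2 sqr_ge0.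
by move=> /allP/(_ j (mem_index_enum _)); rewrite /= mxE -expr2 sqrf_eq0 => /eqP.
Qed.

Lemma gram_unit (R : realFieldType) (m n : nat) (A : 'M[R]_(m, n)) :
  row_free A -> A *m A^T \in unitmx.
Proof.
move=> fA; rewrite -row_free_unit -kermx_eq0; apply/eqP.
set K := kermx _; apply: (row_free_inj fA); rewrite mul0mx.
apply: gram_eq0; rewrite trmx_mul mulmxA -[K *m A *m A^T]mulmxA.
by rewrite /K mulmx_ker mul0mx.
Qed.

Lemma penrose_factor (R : realFieldType) (m n r : nat)
    (C : 'M[R]_(m, r)) (F : 'M[R]_(r, n)) :
  C^T *m C \in unitmx -> F *m F^T \in unitmx ->
  penrose (C *m F)
    (F^T *m invmx (F *m F^T) *m (invmx (C^T *m C) *m C^T)).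
Proof.
move=> uC uF; set P := invmx (F *m F^T); set Q := invmx (C^T *m C).
have Psym : P^T = P by rewrite /P trmx_inv trmx_mul trmxK.
have Qsym : Q^T = Q by rewrite /Q trmx_inv trmx_mul trmxK.
set Y := F^T *m P; set Z := Q *m C^T.
have FY : F *m Y = 1%:M by rewrite /Y mulmxA mulmxV.
have ZC : Z *m C = 1%:M by rewrite /Z -mulmxA mulVmx.
have AX : C *m F *m (Y *m Z) = C *m Z by rewrite mulmxA -(mulmxA C) FY mulmx1.
have XA : Y *m Z *m (C *m F) = Y *m F by rewrite mulmxA -(mulmxA Y) ZC mulmx1.
apply/and4P; split; apply/eqP.
- by rewrite AX mulmxA -(mulmxA C) ZC mulmx1.
- by rewrite XA mulmxA -(mulmxA Y) FY mulmx1.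
- by rewrite AX /Z !trmx_mul trmxK Qsym mulmxA.
- by rewrite XA /Y !trmx_mul trmxK Psym mulmxA.
Qed.

Lemma penrose_exists (R : realFieldType) (m n : nat) (A : 'M[R]_(m, n)) :
  exists X, penrose A X.
Proof.
have uF : row_base A *m (row_base A)^T \in unitmx.
  exact/gram_unit/row_base_free.
have uC : (col_base A)^T *m col_base A \in unitmx.
  rewrite -[X in _ *m X]trmxK; apply: gram_unit.
  by rewrite /row_free mxrank_tr; exact: col_base_full.
have := penrose_factor uC uF; rewrite mulmx_base => pA.
exact: (ex_intro (fun X => is_true (penrose A X)) _ pA).
Qed.

Lemma penrose_unique (R : realFieldType) (m n : nat) (A : 'M[R]_(m, n)) X Y :
  penrose A X -> penrose A Y -> X = Y.
Proof.
case/and4P=> /eqP x1 /eqP x2 /eqP x3 /eqP x4.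
case/and4P=> /eqP y1 /eqP y2 /eqP y3 /eqP y4.
have AXY : A *m X = A *m Y.
  by rewrite -{1}y1 -mulmxA -x3 -y3 -trmx_mul mulmxA x1.
have XAY : X *m A = Y *m A.
  by rewrite -{1}y1 mulmxA mulmxA -mulmxA -x4 -y4 -trmx_mul -mulmxA (mulmxA A) x1.
by rewrite -x2 XAY -mulmxA AXY mulmxA y2.
Qed.

Definition mpinv (R : realFieldType) (m n : nat) (A : 'M[R]_(m, n)) :
    'M[R]_(n, m) :=
  xchoose (penrose_exists A).

Lemma mpinvP (R : realFieldType) (m n : nat) (A : 'M[R]_(m, n)) :
  penrose A (mpinv A).
Proof. exact: xchooseP. Qed.

Section Blocks.
Variables (R : rcfType) (N : nat) (ns : 'I_N -> nat).

Definition idblocks (Lambda : forall i, 'M[R]_(ns i)) : {set 'I_N} :=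
  [set i | Lambda i == 1%:M].

Variable J : {set 'I_N}.

(* Common size of the i-th diagonal blocks of Gamma and H.  Indices are
   0-based, so the first and last blocks are i = 0 and i.+1 = N. *)
Definition bsize (i : 'I_N) : nat :=
  if i \in J then (ns i).+1
  else if (i == 0 :> nat) || (i.+1 == N) then ns i
  else (ns i).-1.

Definition Gamma_block (i : 'I_N) : 'M[R]_(bsize i) :=
  if i \in J then (ns i).+1%:R^-1 *: const_mx 1 else 1%:M.

Definition Upsilon_block (i : 'I_N) : 'M[R]_(bsize i) :=
  if i \in J then 0 else 1%:M.

(* The row k : 'I_n is the (k + 1)-st one in 1-based numbering. *)
Definition Umx (n : nat) : 'M[R]_(n, N) :=
  \matrix_(k < n, j < N)
    if [&& ((\sum_(t < N | t < j) ns t) + 1 <= k.+1)%N,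
           (k.+1 <= (\sum_(t < N | t <= j) ns t) + 1)%N & j \in J]
    then (Num.sqrt (ns j).+1%:R)^-1 else 0.

Definition cols_in (n : nat) (U : 'M[R]_(n, N)) : 'M[R]_(n, #|J|) :=
  colsub (fun l : 'I_#|J| => enum_val l) U.

End Blocks.

(* Main.v *)
(* Put A = Sigma B.  Since Sigma is a symmetric idempotent, Gamma equals
   I - A^T (A A^T)^+ A, the orthogonal projector onto ker A.  A vector x lies
   in ker A iff x is constant on each of the groups of consecutive coordinates
   linked by an identity block of Sigma; as identity blocks are never adjacent,
   these groups are disjoint.  The projector onto such vectors is D + U U^T,
   where D selects the coordinates outside all groups and the nonzero columns
   of U are the normalized indicators of the groups.  Comparing cumulative block
   sizes, the i-th diagonal block covers exactly the i-th group when i is in J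
   and ungrouped coordinates otherwise. *)
Require Import Defs.
From mathcomp Require Import all_boot all_order all_algebra.
From mathcomp Require Import zify.
Set Implicit Arguments.
Unset Strict Implicit.
Unset Printing Implicit Defensive.
Import Order.TTheory GRing.Theory Num.Theory.
Local Open Scope ring_scope.

(** * Orthogonal projection onto a kernel through the pseudo-inverse *)

Section KernelProjection.
Variables (R : realFieldType) (m n : nat).

Lemma mulmx_gram_eq0 (p : nat) (X : 'M[R]_(p, m)) (A : 'M[R]_(m, n)) :
  X *m (A *m A^T) = 0 -> X *m A = 0.
Proof.
move=> XA0; apply: gram_eq0.
by rewrite trmx_mul mulmxA -(mulmxA X) XA0 mul0mx.
Qed.

(** Write [P] for the left-hand side. Both [P] and [G] are symmetric, have columns in the kernel of
    [A] and fix such columns, so [P *m G = G] and [G *m P = P]. Transposing the latter gives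
    [P *m G = P]. *)
Lemma kernel_projection_unique (A : 'M[R]_(m, n)) (G : 'M[R]_n) :
  G^T = G -> A *m G = 0 -> (forall X : 'M[R]_n, A *m X = 0 -> G *m X = X) ->
  1%:M - A^T *m mpinv (A *m A^T) *m A = G.
Proof.
move=> Gsym AG0 Gfix; have /and4P[/eqP p1 /eqP p2 /eqP p3 /eqP p4] := mpinvP (A *m A^T).
set M := A *m A^T in p1 p2 p3 p4 *; set P := _ - _.
have Msym : M^T = M by rewrite /M trmx_mul trmxK.
have AP0 : A *m P = 0.
  have /mulmx_gram_eq0 : (1%:M - M *m mpinv M) *m M = 0 by rewrite mulmxBl mul1mx p1 subrr.
  by rewrite /P mulmxBl mulmxBr mul1mx mulmx1 !mulmxA.
have PG : P *m G = G by rewrite /P mulmxBl mul1mx -(mulmxA _ A) AG0 mulmx0 subr0.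
(* The transpose satisfies the Penrose equations of [M^T = M], the two symmetry conditions being
   exchanged. *)
have Xsym : (mpinv M)^T = mpinv M.
  apply: (penrose_unique (A := M)); last exact: mpinvP.
  rewrite -{1}Msym; apply/and4P; split; apply/eqP.
  - by rewrite -!trmx_mul mulmxA p1.
  - by rewrite -!trmx_mul mulmxA p2.
  - by rewrite -trmx_mul p4.
  - by rewrite -trmx_mul p3.
have Psym : P^T = P.
  by rewrite /P linearB /= trmx1 !trmx_mul trmxK Xsym mulmxA.
by rewrite -Psym -(Gfix _ AP0) trmx_mul Psym Gsym.
Qed.

(** With [X := mpinv M], the Penrose equations give [X = M *m X^T *m X = X *m X^T *m M], so [X]
    inherits from [M] its invariance under [S] on either side. *)
Lemma mpinv_sandwich (S M : 'M[R]_m) :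
  S^T = S -> M^T = M -> S *m M = M -> S *m mpinv M *m S = mpinv M.
Proof.
move=> Ssym Msym SM; have /and4P[_ /eqP p2 /eqP p3 /eqP p4] := mpinvP M.
have MS : M *m S = M by rewrite -{1}Msym -{1}Ssym -trmx_mul SM.
set X := mpinv M in p2 p3 p4 *.
have SX : S *m X = X by rewrite -p2 -p4 trmx_mul Msym !mulmxA SM.
have XE : X = X *m X^T *m M by rewrite -{1}p2 -(mulmxA X) -p3 trmx_mul Msym mulmxA.
by rewrite SX [in LHS]XE -(mulmxA _ M) MS -XE.
Qed.

End KernelProjection.

(** * Cumulative block sizes and entries of block diagonal matrices *)

Section BlockOffsets.
Variable N : nat.
Implicit Types (p : 'I_N -> nat) (i j : 'I_N).

(** The bound is a natural number so that [m = N], giving the total size, is allowed. *)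
Definition offset p (m : nat) : nat := (\sum_(t < N | t < m) p t)%N.

Lemma offset0 p : offset p 0 = 0.
Proof. by rewrite /offset big_pred0. Qed.

Lemma offset_total p : offset p N = (\sum_i p i)%N.
Proof. by apply: eq_bigl => t; rewrite ltn_ord. Qed.

Lemma offset_le p i : (\sum_(t < N | t <= i) p t)%N = (offset p i + p i)%N.
Proof.
rewrite (bigD1 i) //= addnC; congr (_ + _)%N.
by apply: eq_bigl => t; rewrite ltn_neqAle andbC.
Qed.

Lemma offsetS p i : offset p i.+1 = (offset p i + p i)%N.
Proof. by rewrite -offset_le; apply: eq_bigl => t; rewrite ltnS. Qed.

Lemma leq_offset p (a b : nat) : (a <= b)%N -> (offset p a <= offset p b)%N.
Proof.
move=> ab; rewrite /offset big_mkcond [leqRHS]big_mkcond /=.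
by apply: leq_sum => t _; case: ltnP => // ta; rewrite (leq_trans ta ab).
Qed.

Lemma offset_lt p i j : (i < j)%N -> (offset p i + p i <= offset p j)%N.
Proof. by move=> ij; rewrite -offsetS leq_offset. Qed.

Lemma leq_offset_total p i : (offset p i + p i <= \sum_i p i)%N.
Proof. by rewrite -offsetS -offset_total leq_offset. Qed.

Variables (V : nmodType) (p : 'I_N -> nat) (n : nat) (e : (\sum_i p i)%N = n).

Lemma block_index (k : 'I_n) : exists i (a : 'I_(p i)), k = cast_ord e (tagnat.Rank i a).
Proof.
case: _ / e k => k; exists (tagnat.sig1 k), (tagnat.sig2 k).
by rewrite cast_ord_id tagnat.sig2K.
Qed.

Lemma block_indexE i (a : 'I_(p i)) :
  cast_ord e (tagnat.Rank i a) = (offset p i + a)%N :> nat.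
Proof. exact: tagnat.RankEsum. Qed.

Lemma block_index_eq i (a b : 'I_(p i)) :
  (cast_ord e (tagnat.Rank i a) == cast_ord e (tagnat.Rank i b)) = (a == b).
Proof.
apply/eqP/eqP => [/(congr1 (@nat_of_ord n))|-> //].
by rewrite !block_indexE => /addnI/val_inj.
Qed.

Lemma block_index_neq i j (a : 'I_(p i)) (b : 'I_(p j)) :
  i != j -> (cast_ord e (tagnat.Rank i a) == cast_ord e (tagnat.Rank j b)) = false.
Proof.
move=> ij; apply/eqP => /cast_ord_inj/(congr1 (@tagnat.sig1 _ _)).
by rewrite !tagnat.Rank1K; apply/eqP.
Qed.

Lemma mxdiag_block (D : forall i, 'M[V]_(p i)) i (a b : 'I_(p i)) :
  castmx (e, e) (\mxdiag_i D i) (cast_ord e (tagnat.Rank i a)) (cast_ord e (tagnat.Rank i b))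
  = D i a b.
Proof.
case: _ / e; rewrite castmx_id !cast_ord_id.
by have /matrixP/(_ a b) := submxblock_diag D i; rewrite mxE.
Qed.

Lemma mxdiag_offblock (D : forall i, 'M[V]_(p i)) i j (a : 'I_(p i)) (b : 'I_(p j)) :
  i != j ->
  castmx (e, e) (\mxdiag_i D i) (cast_ord e (tagnat.Rank i a)) (cast_ord e (tagnat.Rank j b)) = 0.
Proof.
move=> /negbTE ij; case: _ / e; rewrite castmx_id !cast_ord_id mxE.
by case: eqP => [eqij|_]; rewrite ?mxE //; rewrite !tagnat.Rank1K in eqij; rewrite eqij eqxx in ij.
Qed.

End BlockOffsets.

(** * Groups of coordinates linked by identity blocks *)

Section Groups.
Variables (N : nat) (ns : 'I_N -> nat) (J : {set 'I_N}).
Hypothesis ns_gt0 : forall i, (0 < ns i)%N.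
Hypothesis alternating : forall i j : 'I_N, j = i.+1 :> nat -> (i \in J) != (j \in J).
Implicit Types (i j : 'I_N) (k : nat).

(* The block j of Sigma acts on the differences x_k - x_(k+1) for
   offset ns j <= k < offset ns j + ns j, which involve ns j + 1 coordinates. *)
Definition in_group j k := (offset ns j <= k <= offset ns j + ns j)%N.

Definition covered k := [exists (j | j \in J), in_group j k].

(** Block [i.+1] is outside [J], so it lies strictly between [i] and [j], and its positive size
    makes the gap strict. Strictness matters because a group contains both ends of its interval. *)
Lemma offset_gap i j : i \in J -> j \in J -> (i < j)%N -> (offset ns i + ns i < offset ns j)%N.
Proof.
move=> iJ jJ ij; have ltN : (i.+1 < N)%N := leq_ltn_trans ij (ltn_ord j).
pose l := Ordinal ltN.
have := alternating (erefl : l = i.+1 :> nat); rewrite iJ => lJ.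
have lj : (l < j)%N.
  by rewrite ltn_neqAle ij andbT; apply: contraNneq lJ => /val_inj->; rewrite jJ.
have := offset_lt ns lj; have := ns_gt0 l; rewrite -(offsetS ns i) [X in offset ns X]/=; lia.
Qed.

Lemma in_group_inj i j k : i \in J -> j \in J -> in_group i k -> in_group j k -> i = j.
Proof.
move=> iJ jJ /andP[ik ki] /andP[jk kj]; apply/val_inj => /=.
by have [/(offset_gap iJ jJ)|/(offset_gap jJ iJ)|//] := ltngtP i j; lia.
Qed.

Lemma coveredP k : reflect (exists2 j, j \in J & in_group j k) (covered k).
Proof. exact: exists_inP. Qed.

(** A block of [J] gains one coordinate over [ns], and an inner block outside [J] gives it back. The
    surplus before [i] is thus one exactly when the preceding block is in [J], which by alternation
    means [i \notin J]. *)
Lemma offset_bsize i : offset (bsize ns J) i = (offset ns i + ((0 < i) && (i \notin J)))%N.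
Proof.
case: i => i; elim: i => [|i IH] ltN; first by rewrite !offset0.
have ltN' := ltnW ltN; have {IH} := IH ltN'.
rewrite /=.
have := alternating (erefl : Ordinal ltN = (Ordinal ltN').+1 :> nat).
rewrite (offsetS _ (Ordinal ltN')) (offsetS ns (Ordinal ltN')) /= => + ->.
have := ns_gt0 (Ordinal ltN'); rewrite /bsize /=.
(* Block [i] has a successor, so the last-block case of [bsize] cannot occur. *)
rewrite (ltn_eqF ltN) orbF; do 2 case: (_ \in J) => //=; case: (eqVneq i 0) => i0 /=; lia.
Qed.

(** The final surplus is one: a last block in [J] creates it, and a last block outside [J] keeps
    that of its predecessor. The hypothesis rules out a lone block outside [J], which has no
    predecessor. *)
Lemma sum_bsize : (1 < N)%N \/ (exists i, i \in J) -> (\sum_i bsize ns J i)%N = (\sum_i ns i).+1.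
Proof.
move=> hN; have N_gt0 : (0 < N)%N by case: hN => [|[i _]]; [lia | apply: leq_ltn_trans (ltn_ord i)].
have ltN : (N.-1 < N)%N by rewrite prednK.
pose i := Ordinal ltN; have iN : i.+1 = N by rewrite /= prednK.
have offN p : offset p N = (offset p i + p i)%N by rewrite -offsetS iN.
have := ns_gt0 i; rewrite -!offset_total !offN offset_bsize.
rewrite /bsize iN eqxx orbT; case: hN => [N1|[j jJ]]; first by case: (i \in J); lia.
have [N1|N1] := ltnP 1 N; first by case: (i \in J); lia.
have -> : i = j by apply/val_inj; have := ltn_ord j; rewrite /=; lia.
rewrite jJ; lia.
Qed.

(** A block outside [J] omits the boundary coordinates [offset ns i] and [offset ns i + ns i] that
    belong to neighbouring groups. *)
Lemma in_group_block j i a :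
  j \in J -> (a < bsize ns J i)%N -> in_group j (offset (bsize ns J) i + a) = (j == i).
Proof.
move=> jJ; rewrite /bsize /in_group offset_bsize.
have [<-|ji] := eqVneq j i; first by rewrite jJ andbF; lia.
have := ns_gt0 i; have [ij|ij|/val_inj ij] := ltngtP i j; last by rewrite ij eqxx in ji.
  have := offset_lt ns ij; have := ltn_ord j.
  case iJ: (i \in J); first by have := offset_gap iJ jJ ij; lia.
  by case: (eqVneq (i : nat) 0%N); case: (eqVneq i.+1 N) => /=; lia.
have := offset_lt ns ij; have := ns_gt0 j.
case iJ: (i \in J); first by have := offset_gap jJ iJ ij; lia.
lia.
Qed.

Lemma covered_block i a :
  (a < bsize ns J i)%N -> covered (offset (bsize ns J) i + a) = (i \in J).
Proof.
move=> ai; apply/coveredP/idP => [[j jJ]|iJ]; first by rewrite in_group_block // => /eqP<-.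
by exists i; rewrite ?in_group_block.
Qed.

Lemma count_in_group n j :
  (offset ns j + ns j < n)%N -> (\sum_(k < n | in_group j k) 1)%N = (ns j).+1.
Proof.
move=> jn; rewrite -(big_mkord (in_group j) (fun=> 1%N)).
have -> : (ns j).+1 = ((offset ns j + ns j).+1 - offset ns j)%N by lia.
rewrite -[RHS]muln1 -sum_nat_const_nat.
rewrite [RHS](big_nat_widen _ _ _ xpredT _ jn) [RHS](big_nat_widenl _ 0) //=.
by apply: eq_bigl => k; rewrite /in_group ltnS; lia.
Qed.

(** * The projector onto matrices constant on groups *)

Section KernelProjector.
Variables (R : rcfType) (n : nat).
Hypothesis nE : (\sum_i ns i).+1 = n.
Local Notation U := (Umx R ns J n).
Local Notation D := (diag_mx (\row_(k < n) (~~ covered k)%:R : 'rV[R]_n)).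

Lemma leq_offset_lt j : (offset ns j + ns j < n)%N.
Proof. by rewrite -nE ltnS leq_offset_total. Qed.

Lemma UmxE (k : 'I_n) j :
  U k j = if in_group j k && (j \in J) then (Num.sqrt (ns j).+1%:R)^-1 else 0.
Proof. by rewrite mxE offset_le !addn1 !ltnS andbA. Qed.

Lemma Umx_in_group i j (k : 'I_n) : i \in J -> in_group i k ->
  U k j = if j == i then (Num.sqrt (ns i).+1%:R)^-1 else 0.
Proof.
move=> iJ ik; rewrite UmxE; have [->|ji] := eqVneq j i; first by rewrite ik iJ.
case: ifP => // /andP[jk jJ].
by rewrite (in_group_inj jJ iJ jk ik) eqxx in ji.
Qed.

Lemma Umx_uncovered j (k : 'I_n) : ~~ covered k -> U k j = 0.
Proof.
by move=> /coveredP nk; rewrite UmxE; case: ifP => // /andP[jk jJ]; case: nk; exists j.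
Qed.

Lemma Umx_sqr i (k l : 'I_n) : i \in J -> in_group i k -> in_group i l ->
  U k i * U l i = (ns i).+1%:R^-1.
Proof.
move=> iJ ik il; rewrite !(Umx_in_group _ iJ) // eqxx.
by rewrite -invfM -expr2 sqr_sqrtr ?ler0n.
Qed.

Definition constant_on_groups (X : 'M[R]_n) :=
  forall i (k l c : 'I_n), i \in J -> in_group i k -> in_group i l -> X k c = X l c.

Lemma mul_Umx_group i (k : 'I_n) (p : nat) (Y : 'M[R]_(N, p)) c :
  i \in J -> in_group i k -> (U *m Y) k c = U k i * Y i c.
Proof.
move=> iJ ik; rewrite mxE (bigD1 i) //= big1 ?addr0 // => j /negbTE ji.
by rewrite (Umx_in_group _ iJ ik) ji mul0r.
Qed.

Lemma mul_Umx_uncovered (k : 'I_n) (p : nat) (Y : 'M[R]_(N, p)) c :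
  ~~ covered k -> (U *m Y) k c = 0.
Proof.
by move=> nk; rewrite mxE big1 // => j _; rewrite Umx_uncovered // mul0r.
Qed.

Lemma projector_sym : (D + U *m U^T)^T = D + U *m U^T.
Proof. by rewrite linearD /= tr_diag_mx trmx_mul trmxK. Qed.

Lemma projector_constant : constant_on_groups (D + U *m U^T).
Proof.
move=> i k l c iJ ik il; rewrite mxE [RHS]mxE !(mul_Umx_group _ _ iJ) //.
rewrite !(Umx_in_group _ iJ) //.
congr (_ + _); rewrite !mxE.
have /coveredP -> : exists2 j, j \in J & in_group j k by exists i.
have /coveredP -> : exists2 j, j \in J & in_group j l by exists i.
by rewrite !mul0rn.
Qed.

(** On uncovered rows [D] acts as the identity and [U *m U^T] vanishes. On the group of [i], [D]
    vanishes and [U *m U^T] averages [(ns i).+1] equal entries. *)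
Lemma projector_fixes X : constant_on_groups X -> (D + U *m U^T) *m X = X.
Proof.
move=> constX; apply/matrixP => k c.
rewrite mulmxDl -mulmxA mxE mul_diag_mx [X in X + _]mxE [X in X * _ + _]mxE.
have [[i iJ ik]|nk] := coveredP k; last first.
  by rewrite mul_Umx_uncovered ?addr0 ?mul1r //; apply/coveredP.
rewrite mul0r add0r (mul_Umx_group _ _ iJ ik) [X in _ * X]mxE.
rewrite (bigID (fun l : 'I_n => in_group i l)) /= [X in _ + X]big1 ?addr0; last first.
  by move=> l nl; rewrite mxE UmxE (negbTE nl) mul0r.
rewrite mulr_sumr; under eq_bigr => l il.
  rewrite [U^T _ _]mxE mulrA (Umx_sqr iJ ik il) (constX i l k c) //; over.
rewrite sumr_const -sum1_card count_in_group ?leq_offset_lt //.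
by rewrite -[LHS]mulr_natl mulrA mulfV ?mul1r // pnatr_eq0.
Qed.

Lemma Umx_gramE (k l : 'I_n) i : i \in J -> in_group i k ->
  (U *m U^T) k l = if in_group i l then (ns i).+1%:R^-1 else 0.
Proof.
move=> iJ ik; rewrite (mul_Umx_group _ _ iJ ik) [U^T _ _]mxE.
case: ifP => il; first exact: Umx_sqr.
by rewrite [U l i]UmxE il mulr0.
Qed.

Section BlockDiagonalForm.
Variable e : (\sum_i bsize ns J i)%N = n.

Lemma cast_mxdiag_Upsilon : castmx (e, e) (\mxdiag_i Upsilon_block R ns J i) = D.
Proof.
apply/matrixP => k l.
have [i [a ->]] := block_index e k; have [j [b ->]] := block_index e l.
rewrite [RHS]mxE [X in X *+ _]mxE block_indexE covered_block //.
have [ij|ij] := eqVneq i j.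
  case: _ / ij b => b; rewrite mxdiag_block /Upsilon_block.
  by rewrite block_index_eq; case: (i \in J); rewrite !mxE ?mul0rn.
by rewrite mxdiag_offblock // block_index_neq // mulr0n.
Qed.

Lemma cast_mxdiag_Gamma :
  castmx (e, e) (\mxdiag_i Gamma_block R ns J i) = D + U *m U^T.
Proof.
rewrite -cast_mxdiag_Upsilon; apply/matrixP => k l; rewrite [RHS]mxE.
have [i [a ->]] := block_index e k; have [j [b ->]] := block_index e l.
have gramE : (U *m U^T) (cast_ord e (tagnat.Rank i a)) (cast_ord e (tagnat.Rank j b)) =
    if (i \in J) && (i == j) then (ns i).+1%:R^-1 else 0.
  have [iJ|iJ] /= := boolP (i \in J); last first.
    by rewrite mul_Umx_uncovered // block_indexE covered_block.
  by rewrite (Umx_gramE _ iJ) !block_indexE !in_group_block ?eqxx.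
rewrite gramE; have [ij|ij] := eqVneq i j; last first.
  by rewrite andbF addr0 !mxdiag_offblock.
case: _ / ij b {gramE} => b; rewrite andbT !mxdiag_block /Gamma_block /Upsilon_block.
by case: (i \in J); rewrite ?addr0 // !mxE add0r mulr1.
Qed.

End BlockDiagonalForm.

Lemma col_Umx_neq0 j : (col j U != 0) = (j \in J).
Proof.
apply/idP/idP => [|jJ].
  apply: contraNT => jJ; apply/eqP/matrixP => k c.
  by rewrite [LHS]mxE UmxE (negbTE jJ) andbF mxE.
(* The first coordinate of group [j] serves as the row where column [j] is nonzero. *)
have lt0 : (offset ns j < n)%N by apply: leq_ltn_trans (leq_offset_lt j); rewrite leq_addr.
apply/eqP => /matrixP/(_ (Ordinal lt0) 0); rewrite [LHS]mxE [RHS]mxE.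
rewrite (Umx_in_group _ jJ) /in_group /= ?leqnn ?leq_addr // eqxx.
by apply/eqP; rewrite invr_eq0 gt_eqF // sqrtr_gt0 ltr0n.
Qed.

Lemma cols_in_gram : cols_in J U *m (cols_in J U)^T = U *m U^T.
Proof.
apply/matrixP => k l; rewrite [LHS]mxE [RHS]mxE.
under eq_bigr => t _ do rewrite [_ k t]mxE [_ t l]mxE [_ l t]mxE.
(* The sum over enumerated columns becomes a sum over [J]; the remaining columns of [U] are zero. *)
rewrite -(big_enum_val (A := mem J) (fun j => U k j * U l j)) /= [RHS](bigID (mem J)) /=.
rewrite [X in _ = _ + X]big1 ?addr0 => [|j /negbTE jJ].
  by apply: eq_bigr => j _; rewrite [U^T _ _]mxE.
by rewrite UmxE jJ andbF mul0r.
Qed.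

End KernelProjector.

End Groups.

(** * [Sigma] as a coordinate selector, and the kernel of [Sigma *m B] *)

Section BlockSelector.
Variables (R : rcfType) (N : nat) (ns : 'I_N -> nat) (m : nat).
Variable Lambda : forall i : 'I_N, 'M[R]_(ns i).
Hypothesis LambdaP : forall i, Lambda i = 0 \/ Lambda i = 1%:M.
Variable e : (\sum_i ns i)%N = m.
Local Notation J := (idblocks Lambda).
Local Notation Sigma := (castmx (e, e) (\mxdiag_i Lambda i)).

Lemma selector_sym : Sigma^T = Sigma.
Proof.
rewrite trmx_cast tr_mxdiag /=; congr castmx; apply: eq_mxdiag => i.
by case: (LambdaP i) => ->; rewrite ?trmx0 ?trmx1.
Qed.

Lemma selector_mul (q : nat) (X : 'M[R]_(m, q)) i (a : 'I_(ns i)) c :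
  (Sigma *m X) (cast_ord e (tagnat.Rank i a)) c
  = if i \in J then X (cast_ord e (tagnat.Rank i a)) c else 0.
Proof.
have -> : (if i \in J then X (cast_ord e (tagnat.Rank i a)) c else 0)
    = (i \in J)%:R * X (cast_ord e (tagnat.Rank i a)) c.
  by case: (_ \in _); rewrite ?mul1r ?mul0r.
have LambdaE (b : 'I_(ns i)) : Lambda i a b = (i \in J)%:R *+ (a == b).
  rewrite inE; case: eqP => [->|]; first by rewrite mxE.
  by case: (LambdaP i) => -> // _; rewrite mxE mul0rn.
rewrite mxE (bigD1 (cast_ord e (tagnat.Rank i a))) //= mxdiag_block LambdaE eqxx mulr1n.
rewrite [X in _ + X]big1 ?addr0 // => k; have [j [b ->]] := block_index e k.
have [ij|ij] := eqVneq i j; last by rewrite mxdiag_offblock // mul0r.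
case: _ / ij b => b; rewrite block_index_eq mxdiag_block LambdaE eq_sym => /negbTE->.
by rewrite mulr0n mul0r.
Qed.

Lemma selector_idem : Sigma *m Sigma = Sigma.
Proof.
apply/matrixP => k l; have [i [a ->]] := block_index e k.
rewrite selector_mul; case: ifP => // iJ.
(* Outside [J], multiplying by the identity exposes the row of [Sigma] as zero. *)
by rewrite -[Sigma]mulmx1 selector_mul iJ.
Qed.

Lemma selected_differences (n : nat) (B : 'M[R]_(m, n)) (X : 'M[R]_n) :
  m.+1 = n ->
  (forall (Y : 'M[R]_n) (k : 'I_m) (l l' c : 'I_n),
     l = k :> nat -> l' = k.+1 :> nat -> (B *m Y) k c = Y l c - Y l' c) ->
  Sigma *m B *m X = 0 <-> constant_on_groups ns J X.
Proof.
move=> mn BE; rewrite -mulmxA; split=> [SBX0 i k l c iJ|constX]; last first.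
  apply/matrixP => k c; have [i [a kE]] := block_index e k.
  rewrite {1}kE selector_mul -kE [RHS]mxE; case: ifP => // iJ.
  have lt_kn : (k < n)%N by rewrite -mn ltnS ltnW.
  have lt_Skn : (k.+1 < n)%N by rewrite -mn ltnS.
  have kv : k = (offset ns i + a)%N :> nat by rewrite kE block_indexE.
  rewrite (BE X k (Ordinal lt_kn) (Ordinal lt_Skn)) //.
  apply/eqP; rewrite subr_eq0; apply/eqP; apply: (constX i) => //;
    rewrite /in_group /= kv; have := ltn_ord a; lia.
have lt_on : (offset ns i < n)%N.
  by rewrite -mn ltnS -e (leq_trans (leq_addr _ _) (leq_offset_total ns i)).
(* Induction on the distance [d] from the start of the group: the row of [B] at position [d] of
   block [i] equates coordinates [d] and [d.+1] of the group. *)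
have first_row d (l0 : 'I_n) :
    l0 = (offset ns i + d)%N :> nat -> (d <= ns i)%N -> X l0 c = X (Ordinal lt_on) c.
  elim: d l0 => [|d IH] l0 l0E dn; first by congr (X _ c); apply/val_inj; rewrite /= l0E addn0.
  have lt_dn : (offset ns i + d < n)%N by rewrite (leq_ltn_trans _ (ltn_ord l0)) // l0E leq_add2l.
  rewrite -(IH (Ordinal lt_dn)) ?(ltnW dn) //; apply/esym/eqP; rewrite -subr_eq0.
  pose k0 := cast_ord e (tagnat.Rank i (Ordinal dn)).
  have k0E : k0 = (offset ns i + d)%N :> nat by rewrite block_indexE.
  rewrite -(BE X k0) ?k0E ?l0E ?addnS //.
  have /matrixP/(_ k0 c) := SBX0.
  by rewrite selector_mul iJ => ->; rewrite mxE.
move=> /andP[ik ki] /andP[il li].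
by rewrite (first_row (k - offset ns i)%N) ?(first_row (l - offset ns i)%N) //; lia.
Qed.

End BlockSelector.

Theorem proposition6 (R : rcfType) (n N : nat)
    (B : 'M[R]_(n.-1, n))
    (hB : forall (x : 'cV[R]_n) (i : 'I_n.-1) (j k : 'I_n),
        j = i :> nat -> k = i.+1 :> nat -> (B *m x) i 0 = x j 0 - x k 0)
    (ns : 'I_N -> nat)
    (ns_gt0 : forall i, (0 < ns i)%N)
    (hns : (\sum_(i < N) ns i)%N = n.-1)
    (Lambda : forall i : 'I_N, 'M[R]_(ns i))
    (hLambda : forall i, Lambda i = 0 \/ Lambda i = 1%:M)
    (hconsec : forall i j : 'I_N, j = i.+1 :> nat ->
        (i \in idblocks Lambda) != (j \in idblocks Lambda))
    (hdim : (1 < N)%N \/ exists i, Lambda i = 1%:M) :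
  let J := idblocks Lambda in
  let Sigma : 'M[R]_(n.-1) := castmx (hns, hns) (\mxdiag_(i < N) Lambda i) in
  let Gamma : 'M[R]_n :=
    1%:M - B^T *m mpinv (Sigma *m B *m B^T *m Sigma) *m B in
  let U : 'M[R]_(n, N) := Umx R ns J n in
  let UJ : 'M[R]_(n, #|J|) := cols_in J U in
  (forall j : 'I_N, (col j U != 0) = (j \in J)) /\
  exists e : (\sum_(i < N) bsize ns J i)%N = n,
    let H : 'M[R]_n := castmx (e, e) (\mxdiag_(i < N) Upsilon_block R ns J i) in
    [/\ Gamma = castmx (e, e) (\mxdiag_(i < N) Gamma_block R ns J i),
        Gamma = H + U *m U^T
      & Gamma = H + UJ *m UJ^T].
Proof.
move=> J Sigma Gamma U UJ.
have hN : (1 < N)%N \/ exists i, i \in J.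
  by case: hdim => [|[i Li]]; [left | right; exists i; rewrite inE Li].
(* Since [n.-1] is truncated, [0 < n] has to be derived: some block exists and has positive size. *)
have nE : (\sum_(i < N) ns i).+1 = n.
  have [i0 _] : exists i : 'I_N, true.
    by case: hN => [N1|[i _]]; [exists (Ordinal (ltnW N1)) | exists i].
  have := leq_offset_total ns i0; have := ns_gt0 i0; rewrite hns; lia.
have Sigma_sym : Sigma^T = Sigma by exact: selector_sym.
have kerE X : Sigma *m B *m X = 0 <-> constant_on_groups ns J X.
  apply: selected_differences => [//||Y k l l' c lE l'E]; first by rewrite -hns.
  (* [hB] concerns column vectors, so it is applied to each column of [Y]. *)
  by have := hB (col c Y) k l l' lE l'E; rewrite {1}[col c Y]colE mulmxA -colE ![col c _ _ _]mxE.
have GammaE : Gamma = diag_mx (\row_(k < n) (~~ covered ns J k)%:R) + U *m U^T.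
  have AA : Sigma *m B *m B^T *m Sigma = (Sigma *m B) *m (Sigma *m B)^T.
    by rewrite trmx_mul Sigma_sym !mulmxA.
  (* Inserting [Sigma] on both sides of the pseudo-inverse turns the outer factors [B^T] and [B]
     into [(Sigma *m B)^T] and [Sigma *m B]. *)
  rewrite /Gamma AA -[mpinv _](mpinv_sandwich (S := Sigma)) //.
  - rewrite !mulmxA -{1}Sigma_sym -trmx_mul -(mulmxA _ Sigma).
    apply: kernel_projection_unique => [|| X].
    + exact: projector_sym.
    + by apply/kerE; exact: projector_constant.
    + by move/kerE; exact: projector_fixes.
  - by rewrite trmx_mul trmxK.
  - by rewrite !mulmxA selector_idem.
split; first exact: col_Umx_neq0.
have e : (\sum_(i < N) bsize ns J i)%N = n by rewrite sum_bsize.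
exists e => H; have HE : H = diag_mx (\row_(k < n) (~~ covered ns J k)%:R).
  exact: cast_mxdiag_Upsilon.
by rewrite cols_in_gram // HE cast_mxdiag_Gamma.
Qed.
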